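(* Let $D:\mathfrak a\to\mathfrak b$ be a right deformation map on a quasi-twilled Lie conformal algebra $(\mathcal E,\mathfrak a,\mathfrak b)$. Then the product $$\{a_\lambda b\}^D_{\mathfrak a}=\{a_\lambda b\}_{\mathfrak a}+\varrho_{\mathfrak b}(D(a))_\lambda b-\varrho_{\mathfrak b}(D(b))_{-\lambda-\partial}a,\qquad a,b\in\mathfrak a,$$ defines a Lie conformal algebra structure on $\mathfrak a$.
   Context: All vector spaces and linear maps are over $\mathbb C$, and all $\mathbb C[\partial]$-modules are finitely generated. A Lie conformal algebra is a $\mathbb C[\partial]$-module $\mathcal E$ with a $\mathbb C$-linear map $\mathcal E\otimes\mathcal E\to\mathcal E[\lambda]$, $x\otimes y\mapsto\{x_\lambda y\}$, such that $\{\partial x_\lambda y\}=-\lambda\{x_\lambda y\}$, $\{x_\lambda\partial y\}=(\partial+\lambda)\{x_\lambda y\}$, $\{x_\lambda y\}=-\{y_{-\lambda-\partial}x\}$ and $\{x_\lambda\{y_\mu z\}\}=\{\{x_\lambda y\}_{\lambda+\mu}z\}+\{y_\mu\{x_\lambda z\}\}$. Here and below the subscript $-\lambda-\partial$ means that the formal variable is replaced by $-\lambda-\partial$, with $\partial$ acting from the left on the coefficients. $\mathbb C[\partial]$-module maps are extended to polynomials coefficientwise. A quasi-twilled Lie conformal algebra $(\mathcal E,\mathfrak a,\mathfrak b)$ is a Lie conformal algebra $\mathcal E$ with a decomposition $\mathcal E=\mathfrak a\oplus\mathfrak b$ of $\mathbb C[\partial]$-modules such that $\mathfrak b$ is a Lie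 conformal subalgebra. With $\mathrm{pr}_{\mathfrak a},\mathrm{pr}_{\mathfrak b}$ the projections, for $a,b\in\mathfrak a$, $u,v\in\mathfrak b$ set $\{a_\lambda b\}_{\mathfrak a}=\mathrm{pr}_{\mathfrak a}\{a_\lambda b\}$, $\psi_{1,\lambda}(a,b)=\mathrm{pr}_{\mathfrak b}\{a_\lambda b\}$, $\varrho_{\mathfrak b}(u)_\lambda a=\mathrm{pr}_{\mathfrak a}\{u_\lambda a\}$, $\varrho_{\mathfrak a}(a)_\lambda v=\mathrm{pr}_{\mathfrak b}\{a_\lambda v\}$, $\{u_\lambda v\}_{\mathfrak b}=\mathrm{pr}_{\mathfrak b}\{u_\lambda v\}=\{u_\lambda v\}$. A right deformation map of $(\mathcal E,\mathfrak a,\mathfrak b)$ is a $\mathbb C[\partial]$-module homomorphism $D:\mathfrak a\to\mathfrak b$ whose graph $\mathrm{Gr}(D)=\{(a,D(a))\mid a\in\mathfrak a\}\subset\mathfrak a\oplus\mathfrak b=\mathcal E$ is a Lie conformal subalgebra of $\mathcal E$. *)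

(* Defs.v *)
From HB Require Import structures.
From mathcomp Require Import all_boot all_order all_algebra.
From mathcomp Require Import boolp classical_sets reals.
From mathcomp Require Import complex.
From mathcomp Require Import finmap monalg.

Set Implicit Arguments.
Unset Strict Implicit.
Unset Printing Implicit Defensive.

Import GRing.Theory.
Local Open Scope ring_scope.

(* For an abelian group V, the group V[lambda] is [{malg V[nat]}]: finitely   *)
(* supported families of coefficients, with [p@_k] the coefficient of         *)
(* lambda^k in p and [<< v *g k >>] the monomial v lambda^k. The group        *)
(* V[lambda, mu] is (V[lambda])[mu]: the outer variable is mu, the inner one  *)
(* is lambda.                                                                 *)
Section PolynomialsWithCoefficientsInAGroup.
Variables V W : zmodType.

Definition cstp (v : V) : {malg V[nat]} := << v *g 0%N >>.

Definition mulvar (p : {malg V[nat]}) : {malg V[nat]} :=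
  \sum_(k <- msupp p) << p@_k *g k.+1 >>.

(* Coefficientwise extension, meant for additive f. *)
Definition coefmap (f : V -> W) (p : {malg V[nat]}) : {malg W[nat]} :=
  \sum_(k <- msupp p) << f p@_k *g k >>.

(* [subst T f p] replaces the variable of p = sum_k v_k lambda^k by the       *)
(* operator T of W, acting from the left on the coefficients, which are sent  *)
(* to W by f; this is sum_k T^k (f v_k).                                      *)
Definition subst (T : W -> W) (f : V -> W) (p : {malg V[nat]}) : W :=
  \sum_(k <- msupp p) iter k T (f p@_k).

End PolynomialsWithCoefficientsInAGroup.

(* C[partial] is {poly R[i]}; partial acts on a module as ['X *: _] and a     *)
(* complex scalar c as [c%:P *: _].                                           *)
Section LieConformalAlgebras.
Variable R : realType.

Definition finitely_generated (V : lmodType {poly R[i]}) : Prop :=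
  exists (n : nat) (g : 'I_n -> V),
    forall x, exists c : 'I_n -> {poly R[i]}, x = \sum_i c i *: g i.

Definition lambda_product (V : lmodType {poly R[i]}) : Type :=
  V -> V -> {malg V[nat]}.

Definition dpart (V : lmodType {poly R[i]}) (x : V) : V := 'X *: x.

(* The substitution lambda := - lambda - partial in V[lambda]. *)
Definition subst_opp (V : lmodType {poly R[i]}) (p : {malg V[nat]}) :
    {malg V[nat]} :=
  subst (fun q => - mulvar q - coefmap (@dpart V) q) (@cstp V) p.

Section Jacobi.
Variables (V : lmodType {poly R[i]}) (br : lambda_product V).

Definition mul_lambda : {malg {malg V[nat]}[nat]} -> {malg {malg V[nat]}[nat]} :=
  coefmap (@mulvar V).

Definition mul_mu : {malg {malg V[nat]}[nat]} -> {malg {malg V[nat]}[nat]} :=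
  @mulvar {malg V[nat]}.

(* {x_lambda {y_mu z}} *)
Definition jacobi_lm (x y z : V) : {malg {malg V[nat]}[nat]} :=
  coefmap (br x) (br y z).

(* {y_mu {x_lambda z}}; [coefmap (@cstp V)] embeds V[mu] into V[lambda, mu]. *)
Definition jacobi_ml (x y z : V) : {malg {malg V[nat]}[nat]} :=
  subst mul_lambda (fun w => coefmap (@cstp V) (br y w)) (br x z).

(* {{x_lambda y}_(lambda + mu) z} *)
Definition jacobi_sum (x y z : V) : {malg {malg V[nat]}[nat]} :=
  subst mul_lambda
    (fun w => subst (fun q => mul_lambda q + mul_mu q)
                    (fun v => cstp (cstp v)) (br w z))
    (br x y).

End Jacobi.

Record lie_conformal (V : lmodType {poly R[i]}) (br : lambda_product V) : Prop :=
  LieConformal {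
    lc_fg : finitely_generated V;
    lc_addl : forall x x' y, br (x + x') y = br x y + br x' y;
    lc_addr : forall x y y', br x (y + y') = br x y + br x y';
    lc_scalel : forall (c : R[i]) x y,
      br (c%:P *: x) y = coefmap (fun v => c%:P *: v) (br x y);
    lc_scaler : forall (c : R[i]) x y,
      br x (c%:P *: y) = coefmap (fun v => c%:P *: v) (br x y);
    lc_dpartl : forall x y, br (dpart x) y = - mulvar (br x y);
    lc_dpartr : forall x y,
      br x (dpart y) = coefmap (@dpart V) (br x y) + mulvar (br x y);
    lc_skew : forall x y, br x y = - subst_opp (br y x);
    lc_jacobi : forall x y z,
      jacobi_lm br x y z = jacobi_sum br x y z + jacobi_ml br x y z
  }.

Record conformal_subalgebra (V : lmodType {poly R[i]}) (br : lambda_product V)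
    (S : set V) : Prop :=
  ConformalSubalgebra {
    sub_zero : S 0;
    sub_add : forall x y, S x -> S y -> S (x + y);
    sub_scale : forall (p : {poly R[i]}) x, S x -> S (p *: x);
    sub_bracket : forall x y, S x -> S y -> forall k, S (br x y)@_k
  }.

Section QuasiTwilled.
(* E = a (+) b is the product module, with projections fst and snd. *)
Variables a b : lmodType {poly R[i]}.

Definition in_a (x : a) : a * b := (x, 0).
Definition in_b (u : b) : a * b := (0, u).

Definition quasi_twilled (br : lambda_product (a * b)%type) : Prop :=
  lie_conformal br /\ conformal_subalgebra br (range in_b).

Variable br : lambda_product (a * b)%type.

Definition pr_a : {malg (a * b)%type[nat]} -> {malg a[nat]} := coefmap fst.

Definition bracket_a (x y : a) : {malg a[nat]} := pr_a (br (in_a x) (in_a y)).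

Definition rho_b (u : b) (x : a) : {malg a[nat]} := pr_a (br (in_b u) (in_a x)).

Definition graph (D : {linear a -> b}) : set (a * b) :=
  range (fun x => (x, D x)).

Definition right_deformation_map (D : {linear a -> b}) : Prop :=
  conformal_subalgebra br (graph D).

Definition deformed_bracket (D : {linear a -> b}) : lambda_product a :=
  fun x y => bracket_a x y + rho_b (D x) y - subst_opp (rho_b (D y) x).

End QuasiTwilled.

End LieConformalAlgebras.

(* Main.v *)
Require Import Defs.
From mathcomp Require Import all_boot all_order all_algebra.
From mathcomp Require Import reals complex.
From HB Require Import structures.
From mathcomp Require Import classical_sets finmap monalg.

(** Write [g x = (x, D x)] for the parametrization of the graph of [D]. The
    deformed bracket is the bracket of the graph read through [g]: expanding
    [{g x _lambda g y}] by biadditivity and projecting to [a] gives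
    [{x_lambda y}_a], then [rho_b (D x) y], then the projection of
    [{x_lambda D y}], which skew-symmetry of the ambient bracket turns into
    [- rho_b (D y)_(- lambda - partial) x], and finally the projection of
    [{D x _lambda D y}], which vanishes since [b] is a subalgebra. As the graph
    is a subalgebra, [{g x _lambda g y}] has its coefficients in the graph, so
    it is recovered from its projection by applying [g]
    ([graph_map_deformed_bracket]): [g] is an injective module map intertwining
    the two brackets.

    It remains to see that, on a finitely generated module, a bracket which an
    injective module map intertwines with a Lie conformal bracket is Lie
    conformal ([lie_conformal_pullback]); here [a] is finitely generated as a
    quotient of the ambient module. Each identity among the axioms is an equation between expressions built from the bracket, from
    coefficientwise maps, and from substitutions of operators for the formal
    variable; all of these are natural in the module ([coefmap_mulvar],
    [coefmap_subst_opp], [subst_natural]), so the identity holds after applying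
    the map to the coefficients, and injectivity removes the map. *)

Set Implicit Arguments.
Unset Strict Implicit.
Unset Printing Implicit Defensive.

Import GRing.Theory.
Local Open Scope ring_scope.

(** * Polynomials with coefficients in an abelian group *)

Section Coefficients.
Variables V W : zmodType.
Implicit Types (p : {malg V[nat]}) (k : nat).

Lemma mcoeff_sumU (X : {fset nat}) (c : nat -> W) k :
  (\sum_(j <- X) << c j *g j >>)@_k = if k \in X then c k else 0.
Proof.
rewrite raddf_sum /=; case: ifPn => [kX | kX].
  rewrite (big_fsetD1 k kX) /= mcoeffUU big1_fset ?addr0 // => j.
  by rewrite !inE => /andP[/negPf nejk _] _; rewrite mcoeffU nejk.
rewrite big1_fset // => j jX _; rewrite mcoeffU.
by case: eqVneq => // ejk; rewrite -ejk jX in kX.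
Qed.

Lemma mcoeff_coefmap (f : V -> W) p k :
  f 0 = 0 -> (coefmap f p)@_k = f p@_k.
Proof.
by move=> f0; rewrite mcoeff_sumU; case: msuppP => //; rewrite f0.
Qed.

Lemma mcoeff_mulvar p k :
  (mulvar p)@_k = if k is k'.+1 then p@_k' else 0.
Proof.
rewrite raddf_sum /=; case: k => [|k].
  by rewrite big1_fset // => j _ _; rewrite mcoeffU.
rewrite [in RHS](monalgE p) raddf_sum /=.
by apply: eq_bigr => j _; rewrite !mcoeffU eqSS.
Qed.

End Coefficients.

Section Coefmap.
Variables V W : zmodType.

Lemma coefmap_is_zmod_morphism (f : {additive V -> W}) :
  zmod_morphism (coefmap f).
Proof.
move=> p q; apply/malgP => k.
by rewrite mcoeffB !mcoeff_coefmap ?raddf0 // mcoeffB raddfB.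
Qed.

HB.instance Definition _ (f : {additive V -> W}) :=
  GRing.isZmodMorphism.Build {malg V[nat]} {malg W[nat]} (coefmap f)
    (coefmap_is_zmod_morphism f).

Lemma coefmap_inj (f : V -> W) : f 0 = 0 -> injective f ->
  injective (coefmap f).
Proof.
move=> f0 f_inj p q epq; apply/malgP => k; apply: f_inj.
by rewrite -!mcoeff_coefmap // epq.
Qed.

Lemma eq_coefmap (f g : V -> W) : f =1 g -> coefmap f =1 coefmap g.
Proof. by move=> efg p; apply: eq_bigr => k _; rewrite efg. Qed.

Lemma coefmap_mulvar (f : V -> W) p : f 0 = 0 ->
  coefmap f (mulvar p) = mulvar (coefmap f p).
Proof.
move=> f0; apply/malgP => k; rewrite mcoeff_coefmap // !mcoeff_mulvar.
by case: k => [|k] //; rewrite mcoeff_coefmap.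
Qed.

Lemma coefmap_cstp (f : V -> W) v : f 0 = 0 ->
  coefmap f (cstp v) = cstp (f v).
Proof.
move=> f0; apply/malgP => k; rewrite mcoeff_coefmap // !mcoeffU.
by case: eqP.
Qed.

End Coefmap.

Lemma coefmap_comp (U V W : zmodType) (f : V -> W) (g : U -> V) p :
  f 0 = 0 -> g 0 = 0 -> coefmap f (coefmap g p) = coefmap (f \o g) p.
Proof.
move=> f0 g0; apply/malgP => k; rewrite !mcoeff_coefmap //=.
by rewrite g0.
Qed.

Lemma subst0 (V W : zmodType) (T : W -> W) (f : V -> W) : subst T f 0 = 0.
Proof. by rewrite /subst msupp0 big_seq_fset0. Qed.

(** Naturality of substitution. The two sides are sums over different supports,
    since [g] may kill coefficients; the extra terms are [iter k T' 0]. *)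
Lemma subst_natural (V W V' W' : zmodType) (h : {additive W -> W'})
    (g : V -> V') (T : W -> W) (f : V -> W) (T' : W' -> W') (f' : V' -> W') p :
    (forall w, h (T w) = T' (h w)) -> (forall v, h (f v) = f' (g v)) ->
    T' 0 = 0 -> f' 0 = 0 -> g 0 = 0 ->
  h (subst T f p) = subst T' f' (coefmap g p).
Proof.
move=> hT hf T'0 f'0 g0; rewrite /subst raddf_sum /=.
have h_iter k w : h (iter k T w) = iter k T' (h w).
  by elim: k => //= k <-; rewrite hT.
have iter0 k : iter k T' 0 = 0 by elim: k => //= k ->.
under eq_bigr do rewrite h_iter hf -(mcoeff_coefmap _ _ g0).
apply/esym/big_fset_incl => [|k _ /mcoeff_outdom ->]; last by rewrite f'0 iter0.
apply/fsubsetP => k; rewrite -!mcoeff_neq0 mcoeff_coefmap //.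
by apply: contraNneq => ->; rewrite g0.
Qed.

(** * Transport of Lie conformal structures *)

Section Transport.
Variable R : realType.

(** The substitution involves the action of partial on the coefficients, so
    naturality uses that [f] commutes with it. *)
Lemma coefmap_subst_opp (V W : lmodType {poly R[i]}) (f : {linear V -> W}) p :
  coefmap f (subst_opp p) = subst_opp (coefmap f p).
Proof.
have f0 : f 0 = 0 := raddf0 f.
have d0 (U : lmodType {poly R[i]}) : dpart (0 : U) = 0 by exact: scaler0.
apply: subst_natural => //.
- move=> q; rewrite raddfB raddfN /= coefmap_mulvar // !coefmap_comp ?d0 //.
  by congr (_ - _); apply: eq_coefmap => v /=; rewrite /dpart linearZ.
- by move=> v; rewrite /= coefmap_cstp.
- apply/malgP => k; rewrite mcoeffB mcoeffN mcoeff_mulvar mcoeff_coefmap ?d0 //.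
  by rewrite !mcoeff0 d0; case: k => [|k]; rewrite ?mcoeff0 !subr0 oppr0.
- by apply/malgP => k; rewrite mcoeffU mul0rn mcoeff0.
Qed.

Lemma finitely_generated_surj (V W : lmodType {poly R[i]})
    (f : {linear V -> W}) (s : W -> V) :
  cancel s f -> finitely_generated V -> finitely_generated W.
Proof.
move=> sK [n [e e_gen]]; exists n, (f \o e) => w.
have [c ec] := e_gen (s w); exists c.
by rewrite -[LHS]sK ec linear_sum; apply: eq_bigr => i _; rewrite linearZ.
Qed.

Section Pullback.
Variables (V W : lmodType {poly R[i]}) (brV : lambda_product V).
Variables (brW : lambda_product W) (f : {linear V -> W}).
Hypothesis lcW : lie_conformal brW.
Hypothesis f_inj : injective f.
Hypothesis f_br : forall x y, coefmap f (brV x y) = brW (f x) (f y).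

Let f0 : f 0 = 0 := raddf0 f.
Let F0 : coefmap f 0 = 0 := raddf0 (coefmap f).
Let F_inj : injective (coefmap f) := coefmap_inj f0 f_inj.
Let FF_inj : injective (coefmap (coefmap f)) := coefmap_inj F0 F_inj.

Let brW0 x : brW x 0 = 0.
Proof. by apply: (addrI (brW x 0)); rewrite -(lc_addr lcW) !addr0. Qed.

Let br0W x : brW 0 x = 0.
Proof. by apply: (addrI (brW 0 x)); rewrite -(lc_addl lcW) !addr0. Qed.

Let brV0 x : brV x 0 = 0.
Proof. by apply: F_inj; rewrite f_br F0 f0 brW0. Qed.

Let cstp0 (U : zmodType) : cstp (0 : U) = 0.
Proof. by apply/malgP => k; rewrite mcoeffU mul0rn mcoeff0. Qed.

Let mulvar0 (U : zmodType) : mulvar (0 : {malg U[nat]}) = 0.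
Proof. by apply/malgP => -[|k]; rewrite mcoeff_mulvar !mcoeff0. Qed.

Let coefmap0 (U U' : zmodType) (g : U -> U') : g 0 = 0 -> coefmap g 0 = 0.
Proof. by move=> g0; apply/malgP => k; rewrite mcoeff_coefmap // !mcoeff0. Qed.

Let coefmap_mul_lambda q :
  coefmap (coefmap f) (mul_lambda q) = mul_lambda (coefmap (coefmap f) q).
Proof.
rewrite /mul_lambda !coefmap_comp ?mulvar0 //.
by apply: eq_coefmap => v /=; rewrite coefmap_mulvar.
Qed.

Let mul_lambda0 (U : lmodType {poly R[i]}) :
  @mul_lambda R U 0 = 0 := coefmap0 (mulvar0 U).

Lemma coefmap_jacobi_lm x y z :
  coefmap (coefmap f) (jacobi_lm brV x y z) = jacobi_lm brW (f x) (f y) (f z).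
Proof.
rewrite /jacobi_lm -f_br !coefmap_comp ?brV0 ?brW0 //.
by apply: eq_coefmap => v /=; rewrite f_br.
Qed.

Lemma coefmap_jacobi_ml x y z :
  coefmap (coefmap f) (jacobi_ml brV x y z) = jacobi_ml brW (f x) (f y) (f z).
Proof.
rewrite /jacobi_ml -f_br; apply: subst_natural => //.
- move=> w /=; rewrite -f_br !coefmap_comp ?cstp0 //.
  by apply: eq_coefmap => v /=; rewrite coefmap_cstp.
- exact: mul_lambda0.
- by rewrite brW0 coefmap0 ?cstp0.
Qed.

Lemma coefmap_jacobi_sum x y z :
  coefmap (coefmap f) (jacobi_sum brV x y z) =
  jacobi_sum brW (f x) (f y) (f z).
Proof.
rewrite /jacobi_sum -f_br; apply: subst_natural => //.
- move=> w; rewrite -f_br; apply: subst_natural => //.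
  + by move=> q; rewrite raddfD /= coefmap_mul_lambda /mul_mu coefmap_mulvar.
  + by move=> v; rewrite /= !coefmap_cstp.
  + by rewrite mul_lambda0 /mul_mu mulvar0 addr0.
  + by rewrite !cstp0.
- exact: mul_lambda0.
- by rewrite br0W subst0.
Qed.

(** Each identity of [brV] is sent by [f], acting on the coefficients, to the
    same identity of [brW] at the images of the arguments; coefficientwise
    extension keeps [f] injective, once for the identities in [V[lambda]] and
    twice for the Jacobi identity in [V[lambda, mu]]. *)
Lemma lie_conformal_pullback : finitely_generated V -> lie_conformal brV.
Proof.
have comp_scale (c : {poly R[i]}) p :
    coefmap f (coefmap (fun v => c *: v) p) =
    coefmap (fun v => c *: v) (coefmap f p).
  rewrite !coefmap_comp ?scaler0 //.
  by apply: eq_coefmap => v /=; rewrite linearZ.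
move=> fgV; split=> //.
- by move=> x x' y; apply: F_inj; rewrite raddfD /= !f_br raddfD (lc_addl lcW).
- by move=> x y y'; apply: F_inj; rewrite raddfD /= !f_br raddfD (lc_addr lcW).
- move=> c x y; apply: F_inj.
  by rewrite comp_scale !f_br linearZ (lc_scalel lcW).
- move=> c x y; apply: F_inj.
  by rewrite comp_scale !f_br linearZ (lc_scaler lcW).
- move=> x y; apply: F_inj.
  by rewrite raddfN /= coefmap_mulvar // !f_br linearZ (lc_dpartl lcW).
- move=> x y; apply: F_inj.
  rewrite raddfD /= coefmap_mulvar // comp_scale !f_br linearZ.
  exact: (lc_dpartr lcW).
- move=> x y; apply: F_inj.
  by rewrite raddfN /= coefmap_subst_opp !f_br -(lc_skew lcW).
- move=> x y z; apply: FF_inj.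
  rewrite raddfD /= coefmap_jacobi_lm coefmap_jacobi_sum coefmap_jacobi_ml.
  exact: (lc_jacobi lcW).
Qed.

End Pullback.
End Transport.

(** * The deformed bracket and the graph *)

Section Graph.
Variables (R : realType) (a b : lmodType {poly R[i]}).
Variables (br : lambda_product (a * b)%type) (D : {linear a -> b}).

Definition graph_map (x : a) : a * b := (x, D x).

Lemma graph_map_is_linear : linear graph_map.
Proof. by move=> c x y; rewrite /graph_map linearP. Qed.

HB.instance Definition _ :=
  GRing.isLinear.Build {poly R[i]} a (a * b)%type *:%R graph_map
    graph_map_is_linear.

Lemma graph_map_inj : injective graph_map.
Proof. by move=> x y []. Qed.

(** Of the four terms of the bracket of two points of the graph, the one with
    both arguments in [b] projects to zero on [a], and the one with only the
    second argument in [b] is turned by skew-symmetry into the substitution term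
    of the deformed bracket. *)
Lemma deformed_bracketE : quasi_twilled br ->
  forall x y, deformed_bracket br D x y =
              coefmap fst (br (graph_map x) (graph_map y)).
Proof.
move=> [lcE subb] x y.
have split_graph z : graph_map z = in_a b z + in_b a (D z).
  by congr (_, _); rewrite ?addr0 ?add0r.
have b_closed u v : coefmap fst (br (in_b a u) (in_b a v)) = 0.
  apply/malgP => k; rewrite mcoeff_coefmap // mcoeff0.
  have in_range (w : b) : (range (@in_b R a b)) (in_b a w) by exists w.
  by have [w _ <-] := sub_bracket subb (in_range u) (in_range v) k.
rewrite !split_graph (lc_addl lcE) !(lc_addr lcE) !raddfD /= b_closed addr0.
rewrite (lc_skew lcE (in_a b x) (in_b a (D y))) raddfN /= coefmap_subst_opp.
by rewrite addrAC.
Qed.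

(** An element of the graph is determined by its [a]-component, so closure of
    the graph under the bracket lets [graph_map] undo the projection in
    [deformed_bracketE]. *)
Lemma graph_map_deformed_bracket :
    quasi_twilled br -> right_deformation_map br D ->
  forall x y, coefmap graph_map (deformed_bracket br D x y) =
              br (graph_map x) (graph_map y).
Proof.
move=> hE hD x y; apply/malgP => k.
rewrite deformed_bracketE // !mcoeff_coefmap ?raddf0 //.
have in_graph z : graph D (graph_map z) by exists z.
by have [w _ <-] := sub_bracket hD (in_graph x) (in_graph y) k.
Qed.

End Graph.

Theorem theorem3p10 (R : realType) (a b : lmodType {poly R[i]})
    (br : lambda_product (a * b)%type) (hE : quasi_twilled br)
    (D : {linear a -> b}) (hD : right_deformation_map br D) :
  lie_conformal (deformed_bracket br D).
Proof.
have [lcE _] := hE.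
apply: (lie_conformal_pullback lcE (@graph_map_inj _ _ _ D)).
  exact: graph_map_deformed_bracket.
exact: (@finitely_generated_surj _ _ _ fst (@in_a _ a b)) (lc_fg lcE).
Qed.
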